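(* Let $G=(V,E)$ be a (possibly nonconnected) graph with at least one edge, and let $|G\rangle$ be the associated graph state. Let $\nu(G)$ be the maximum spectral gap of verification operators of $|G\rangle$ based on (nonadaptive) Pauli measurements, and let $\nu_{\mathrm{sep}}(G)$ be the maximum spectral gap of verification operators of $|G\rangle$ based on separable measurements. Then $$\nu(G)\leq \nu_{\mathrm{sep}}(G)\leq \frac{2}{3}.$$
   Context: Graphs are finite and simple, with vertex set $V=\{1,\dots,n\}$. The graph state $|G\rangle\in(\mathbb{C}^2)^{\otimes n}$ is the unique (up to phase) unit vector that is a common $+1$ eigenvector of the operators $S_j=X_j\prod_{k:\{j,k\}\in E}Z_k$, $j=1,\dots,n$, where $X_j,Y_j,Z_j$ are the Pauli matrices acting on qubit $j$. A test operator for a target state $|\Psi\rangle$ is an operator $E$ with $0\le E\le \mathbb{1}$ and $E|\Psi\rangle=|\Psi\rangle$. A verification operator is a finite convex combination $\Omega=\sum_k p_kE_k$ of test operators ($p_k\ge0$, $\sum_kp_k=1$). $\beta(\Omega)$ is the second largest eigenvalue of $\Omega$ (counted with multiplicity; the largest is $1$, attained at $|\Psi\rangle$), and $\nu(\Omega)=1-\beta(\Omega)$ is the spectral gap. A Pauli measurement on $n$ qubits measures on each qubit one of $X,Y,Z$ (or nothing); its outcome projectors $\Pi_{\mathbf v}$ are the tensor products over the qubits of the eigenprojectors of the measured single-qubit Pauli operators (identity on unmeasured qubits). A test operator based on this Pauli measurement is a test operator that is a linear combination of the $\Pi_{\mathbf v}$. A verification operator is based on Pauli measurements if every $E_k$ is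 a test operator based on some Pauli measurement. An operator on $(\mathbb{C}^2)^{\otimes n}$ is separable if it is a nonnegative linear combination of projectors onto pure product states; a verification operator is based on separable measurements if for every $k$ both $E_k$ and $\mathbb{1}-E_k$ are separable. *)

(* Defs.v *)
From HB Require Import structures.
From mathcomp Require Import all_boot all_order all_algebra.
From mathcomp Require Import spectral sesquilinear complex.
From mathcomp Require Import classical_sets reals.

Set Implicit Arguments.
Unset Strict Implicit.
Unset Printing Implicit Defensive.

Import Order.TTheory GRing.Theory Num.Theory.
Local Open Scope classical_set_scope.
Local Open Scope complex_scope.
Local Open Scope sesquilinear_scope.
Local Open Scope ring_scope.

(* The space (C^2)^{(x) n} is coordinatized by its computational basis, indexed
   by bit strings a : {ffun 'I_n -> 'I_2}.  Matrix indices range over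
   'I_(qdim n), and [enum_val] turns such an index into a bit string, so that a
   tensor product has entries prod_i (A_i)_{a_i, b_i}. *)
Definition qdim (n : nat) : nat := #|{ffun 'I_n -> 'I_2}|.

Definition bits (n : nat) (a : 'I_(qdim n)) : {ffun 'I_n -> 'I_2} := enum_val a.

Definition tens_op (R : realType) (n : nat) (A : 'I_n -> 'M[R[i]]_2) :
    'M[R[i]]_(qdim n) :=
  \matrix_(a, b) \prod_(i < n) A i (bits a i) (bits b i).

Definition tens_ket (R : realType) (n : nat) (v : 'I_n -> 'cV[R[i]]_2) :
    'cV[R[i]]_(qdim n) :=
  \col_a \prod_(i < n) v i (bits a i) 0.

Definition qubit_op (R : realType) (n : nat) (j : 'I_n) (A : 'M[R[i]]_2) :
    'M[R[i]]_(qdim n) :=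
  tens_op (fun i => if i == j then A else 1%:M).

Definition unit_ket (R : realType) (m : nat) (v : 'cV[R[i]]_m) : Prop :=
  (v ^t* *m v) 0 0 = 1.

Variant pauli : Type := PauliX | PauliY | PauliZ.

Definition pauli_mx (R : realType) (s : pauli) : 'M[R[i]]_2 :=
  match s with
  | PauliX => \matrix_(a, b) (a != b)%:R
  | PauliY => \matrix_(a, b)
                (if a == b then 0 else if a == 0 then - 'i%C else 'i%C)
  | PauliZ => \matrix_(a, b) (if a == b then (-1) ^+ a else 0)
  end.

(* The vertex set {1,...,n} is 'I_n; the product over neighbours is taken in
   the order of 'I_n, which is immaterial since the factors commute. *)
Definition stabilizer (R : realType) (n : nat) (e : rel 'I_n) (j : 'I_n) :
    'M[R[i]]_(qdim n) :=
  qubit_op j (pauli_mx R PauliX)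
    *m \big[mulmx/1%:M]_(k < n | e j k) qubit_op k (pauli_mx R PauliZ).

Definition is_graph_state (R : realType) (n : nat) (e : rel 'I_n)
    (psi : 'cV[R[i]]_(qdim n)) : Prop :=
  unit_ket psi /\ (forall j : 'I_n, stabilizer R e j *m psi = psi).

Definition psd (R : realType) (m : nat) (A : 'M[R[i]]_m) : Prop :=
  A \is hermsymmx /\ (forall v : 'cV[R[i]]_m, 0 <= (v ^t* *m A *m v) 0 0).

Definition is_test_op (R : realType) (n : nat) (psi : 'cV[R[i]]_(qdim n))
    (E : 'M[R[i]]_(qdim n)) : Prop :=
  [/\ psd E, psd (1%:M - E) & E *m psi = psi].

(* The predicate [T] is the restriction put on the individual test operators
   (based on Pauli measurements, or on separable measurements). *)
Definition is_verif_op (R : realType) (n : nat) (psi : 'cV[R[i]]_(qdim n))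
    (T : 'M[R[i]]_(qdim n) -> Prop) (Omega : 'M[R[i]]_(qdim n)) : Prop :=
  exists (K : nat) (p : 'I_K -> R) (E : 'I_K -> 'M[R[i]]_(qdim n)),
    [/\ forall k, 0 <= p k,
        \sum_(k < K) p k = 1,
        forall k, is_test_op psi (E k) /\ T (E k)
      & Omega = \sum_(k < K) (p k)%:C *: E k].

(* Eigenprojector of a Pauli matrix s for the eigenvalue (-1)^v, namely
   (1 + (-1)^v s) / 2, and the identity if nothing is measured. *)
Definition local_proj (R : realType) (s : option pauli) (v : bool) :
    'M[R[i]]_2 :=
  if s is Some s' then 2^-1 *: (1%:M + (-1) ^+ v *: pauli_mx R s') else 1%:M.

Definition outcome_proj (R : realType) (n : nat) (s : 'I_n -> option pauli)
    (v : {ffun 'I_n -> bool}) : 'M[R[i]]_(qdim n) :=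
  tens_op (fun i => local_proj R (s i) (v i)).

(* Outcomes carry a bit on every qubit; the bits on unmeasured qubits are
   ignored, so they only repeat projectors and do not enlarge the span. *)
Definition pauli_based (R : realType) (n : nat) (E : 'M[R[i]]_(qdim n)) : Prop :=
  exists (s : 'I_n -> option pauli) (c : {ffun 'I_n -> bool} -> R[i]),
    E = \sum_v c v *: outcome_proj R s v.

Definition separable (R : realType) (n : nat) (A : 'M[R[i]]_(qdim n)) : Prop :=
  exists (K : nat) (c : 'I_K -> R) (v : 'I_K -> 'I_n -> 'cV[R[i]]_2),
    [/\ forall k, 0 <= c k,
        forall k i, unit_ket (v k i)
      & A = \sum_(k < K)
              (c k)%:C *: (tens_ket (v k) *m (tens_ket (v k)) ^t*)].

Definition separable_based (R : realType) (n : nat) (E : 'M[R[i]]_(qdim n)) :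
    Prop :=
  separable E /\ separable (1%:M - E).

(* For Hermitian A, [spectral_diag A] lists the (real) eigenvalues of A with
   multiplicity. *)
Definition eigenvalues_desc (R : realType) (m : nat) (A : 'M[R[i]]_m) : seq R :=
  sort >=%R [seq complex.Re (spectral_diag A 0 i) | i <- enum 'I_m].

Definition beta (R : realType) (m : nat) (A : 'M[R[i]]_m) : R :=
  nth 0 (eigenvalues_desc A) 1.

Definition spectral_gap (R : realType) (m : nat) (A : 'M[R[i]]_m) : R :=
  1 - beta A.

(* The maximum is expressed by [sup].  The set is nonempty (the identity is a
   verification operator of either kind) and bounded above by 1, so [sup] is its
   genuine least upper bound, and equals its maximum when that is attained. *)
Definition max_gap (R : realType) (n : nat) (psi : 'cV[R[i]]_(qdim n))
    (T : 'M[R[i]]_(qdim n) -> Prop) : R :=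
  sup [set spectral_gap Omega | Omega in [set Omega | is_verif_op psi T Omega]].

Definition nu (R : realType) (n : nat) (psi : 'cV[R[i]]_(qdim n)) : R :=
  max_gap psi (@pauli_based R n).

Definition nu_sep (R : realType) (n : nat) (psi : 'cV[R[i]]_(qdim n)) : R :=
  max_gap psi (@separable_based R n).

(* Main.v *)
(* Let jk be an edge.  The vectors X_j psi, Z_j psi and Z_j X_j psi are unit
   vectors orthogonal to psi, since each of these Paulis anticommutes with S_j
   or S_k.  Seen from qubit j the state psi is maximally entangled, so a product
   vector v satisfies
     |<v|psi>|^2 <= |<v|X_j psi>|^2 + |<v|Z_j psi>|^2 + |<v|Z_j X_j psi>|^2.
   Hence a separable E with E psi = psi has expectations summing to at least 1
   in these three vectors, and so does Omega.  If beta(Omega) < 1, the eigenvalue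
   1 is simple, so these expectations are at most beta(Omega), which gives
   beta(Omega) >= 1/3.  For nu <= nu_sep, a Pauli-based operator and its
   complement are diagonal in a product eigenbasis of the Paulis measured, so
   both are separable when positive. *)
Require Import Defs.
From mathcomp Require Import all_boot all_order all_algebra.
From mathcomp Require Import spectral sesquilinear complex.
From mathcomp Require Import classical_sets reals.
From mathcomp Require Import ring lra.
Import Order.TTheory GRing.Theory Num.Theory.
Local Open Scope complex_scope.
Local Open Scope sesquilinear_scope.
Local Open Scope ring_scope.

(** * Expectation values and the second largest eigenvalue *)

Definition expect {R : realType} {m : nat} (A : 'M[R[i]]_m) (v : 'cV[R[i]]_m) : R[i] :=
  (v ^t* *m A *m v) 0 0.

Lemma inner_colE {R : realType} {m : nat} (u v : 'cV[R[i]]_m) :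
  (u ^t* *m v) 0 0 = \sum_a (u a 0)^* * v a 0.
Proof. by rewrite mxE; apply: eq_bigr => a _; rewrite !mxE. Qed.

Lemma norm_colE {R : realType} {m : nat} (v : 'cV[R[i]]_m) :
  (v ^t* *m v) 0 0 = \sum_a `|v a 0| ^+ 2.
Proof. by rewrite inner_colE; apply: eq_bigr => a _; rewrite normCK mulrC. Qed.

Lemma expect_sum {R : realType} {m K : nat} (c : 'I_K -> R[i])
    (E : 'I_K -> 'M[R[i]]_m) (v : 'cV[R[i]]_m) :
  expect (\sum_k c k *: E k) v = \sum_k c k * expect (E k) v.
Proof.
rewrite /expect mulmx_sumr mulmx_suml summxE; apply: eq_bigr => k _.
by rewrite -scalemxAr -scalemxAl mxE.
Qed.

Lemma expect_proj {R : realType} {m : nat} (u v : 'cV[R[i]]_m) :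
  expect (u *m u ^t*) v = `|(u ^t* *m v) 0 0| ^+ 2.
Proof.
rewrite /expect mulmxA -mulmxA mxE big_ord1 normCK mulrC; congr (_ * _).
by rewrite !inner_colE rmorph_sum; apply: eq_bigr => a _; rewrite rmorphM /= conjCK mulrC.
Qed.

(** [beta A] is entry 1 of the decreasingly sorted list, so only entry 0 can exceed it. Counting
    with multiplicity, two distinct indices cannot both lie above it. *)
Lemma eigenvalues_pair {R : realType} {m : nat} (A : 'M[R[i]]_m) (i j : 'I_m) :
  i != j -> complex.Re (spectral_diag A 0 i) <= beta A
         \/ complex.Re (spectral_diag A 0 j) <= beta A.
Proof.
move=> ij; set l := fun i => complex.Re (spectral_diag A 0 i).
rewrite -[complex.Re _]/(l i) -[complex.Re (spectral_diag A 0 j)]/(l j).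
case: (leP (l i) (beta A)) => [|li]; first by left.
case: (leP (l j) (beta A)) => [|lj]; first by right.
have : (count (> beta A)%R (eigenvalues_desc A) <= 1)%N.
  have : sorted >=%R (eigenvalues_desc A) by apply: sort_sorted => x y; exact: le_total.
  (* With fewer than two eigenvalues [beta] is the default 0, but then the length alone bounds the
     count. *)
  rewrite /beta; case: (eigenvalues_desc A) => [|x [|y s]] //=.
    by rewrite addn0 => _; case: (_ < _).
  move=> /andP[_ ys]; rewrite ltxx add0n.
  rewrite (_ : count _ s = 0%N) ?addn0; first by case: (_ < _).
  apply/eqP; rewrite -leqn0 leqNgt -has_count; apply/hasPn => z zs.
  rewrite -leNgt; have := order_path_min _ ys => /(_ _)/allP; apply=> //.
  by move=> a b c /= ab bc; apply: le_trans bc ab.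
rewrite (permP (permEl (perm_sort _ _))) count_map.
have -> : count (preim l (> beta A)%R) (enum 'I_m) = #|[pred k | beta A < l k]|.
  by rewrite cardE -size_filter [in RHS]/enum_mem enumT; congr size; apply: eq_filter.
by move=> /card_le1P /(_ i); rewrite inE => /(_ li j); rewrite !inE lj eq_sym (negPf ij).
Qed.

Lemma expect_spectral {R : realType} {m : nat} (A : 'M[R[i]]_m) (v : 'cV[R[i]]_m) :
  A \is hermsymmx ->
  expect A v = \sum_i (complex.Re (spectral_diag A 0 i))%:C * `|(spectralmx A *m v) i 0| ^+ 2.
Proof.
move=> Ah; rewrite /expect.
have /orthomx_spectralP {1}-> := hermitian_normalmx Ah.
rewrite invmx_unitary ?spectral_unitarymx //.
set P := spectralmx A; set D := spectral_diag A.
have -> : v ^t* *m (P ^t* *m diag_mx D *m P) *m v = (P *m v) ^t* *m (diag_mx D *m (P *m v)).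
  by rewrite trmx_mul map_mxM !mulmxA.
rewrite inner_colE; apply: eq_bigr => i _; move: (P *m v) => x.
rewrite mul_diag_mx mxE RRe_real; last first.
  by have /mxOverP := hermitian_spectral_diag_real Ah; apply.
by rewrite normCK; ring.
Qed.

(** As [beta A < 1], the eigenvalue 1 sits at a single index [i0], so [psi] is a multiple of one
    eigenvector. A vector orthogonal to [psi] has no component there, and all other eigenvalues are
    at most [beta A]. *)
Lemma expect_le_beta {R : realType} {m : nat} (A : 'M[R[i]]_m) (psi phi : 'cV[R[i]]_m) :
  A \is hermsymmx -> unit_ket psi -> A *m psi = psi -> (psi ^t* *m phi) 0 0 = 0 ->
  unit_ket phi -> beta A < 1 -> expect A phi <= (beta A)%:C.
Proof.
move=> Ah psi1 Apsi orth phi1 b1.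
set P := spectralmx A.
have PU : P ^t* *m P = 1%:M.
  rewrite -[P in _ *m P]trmxCK; apply/unitarymxP.
  by rewrite trmxC_unitary spectral_unitarymx.
have innP (u v : 'cV[R[i]]_m) : ((P *m u) ^t* *m (P *m v)) 0 0 = (u ^t* *m v) 0 0.
  by rewrite trmx_mul map_mxM -mulmxA (mulmxA (P ^t*)) PU mul1mx.
have eig i : (P *m psi) i 0 != 0 -> complex.Re (spectral_diag A 0 i) = 1.
  move=> zi; have := congr1 (fun M => (P *m M) i 0) Apsi => /=.
  have /orthomx_spectralP {1}-> := hermitian_normalmx Ah.
  rewrite !mulmxA mulmxV ?spectral_unit // mul1mx -mulmxA mul_diag_mx mxE.
  by move=> /(canRL (mulfK zi)) ->; rewrite divff.
have [i0 z0] : exists i, (P *m psi) i 0 != 0.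
  apply/existsP; case: (pickP (fun i => (P *m psi) i 0 != 0)) => [i zi|z0].
    by apply/existsP; exists i.
  have := innP psi psi; rewrite psi1 norm_colE big1 => [/eqP|i _].
    by rewrite eq_sym oner_eq0.
  by have /negbFE/eqP -> := z0 i; rewrite normr0 expr0n.
have small i : i != i0 -> complex.Re (spectral_diag A 0 i) <= beta A.
  move=> ii0; case: (eigenvalues_pair A i i0 ii0) => // h.
  by move: h; rewrite (eig _ z0) leNgt b1.
(* In the eigenbasis the inner product of [psi] and [phi] reduces to its [i0] term, whose [psi]
   factor is nonzero. *)
have x0 : (P *m phi) i0 0 = 0.
  have := innP psi phi; rewrite orth inner_colE (bigD1 i0) //= big1 ?addr0.
    by move/eqP; rewrite mulf_eq0 conjC_eq0 (negPf z0) => /eqP.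
  move=> i ii0; have [-> | zi] := eqVneq ((P *m psi) i 0) 0.
    by rewrite conjC0 mul0r.
  by move: (small i ii0); rewrite (eig _ zi) leNgt b1.
rewrite expect_spectral // -[leRHS]mulr1 -phi1 -innP norm_colE mulr_sumr.
apply: ler_sum => i _; have [-> | ii0] := eqVneq i i0.
  by rewrite x0 normr0 expr0n /= !mulr0.
by rewrite ler_wpM2r ?exprn_ge0 // lecR small.
Qed.

(** * Bit flips and the action of X and Z on amplitudes *)

Definition flip {n : nat} (j : 'I_n) (f : {ffun 'I_n -> 'I_2}) : {ffun 'I_n -> 'I_2} :=
  [ffun i => if i == j then rev_ord (f i) else f i].

Definition qflip {n : nat} (j : 'I_n) (a : 'I_(qdim n)) : 'I_(qdim n) :=
  enum_rank (flip j (bits a)).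

Lemma bits_inj {n : nat} : injective (@bits n).
Proof. exact: enum_val_inj. Qed.

Lemma sum_bits {V : nmodType} {n : nat} (F : {ffun 'I_n -> 'I_2} -> V) :
  \sum_(a : 'I_(qdim n)) F (bits a) = \sum_f F f.
Proof.
rewrite [RHS](reindex (@bits n)) //; apply: onW_bij; exact: enum_val_bij.
Qed.

Lemma bits_qflip {n : nat} (j : 'I_n) (a : 'I_(qdim n)) (i : 'I_n) :
  bits (qflip j a) i = if i == j then rev_ord (bits a i) else bits a i.
Proof. by rewrite /bits enum_rankK ffunE. Qed.

Lemma qflipK {n : nat} (j : 'I_n) : involutive (qflip j).
Proof.
move=> a; apply: bits_inj; apply/ffunP => i; rewrite !bits_qflip.
by case: (i == j); rewrite ?rev_ordK.
Qed.

Lemma rev_ord2 (b : 'I_2) : (rev_ord b == 0) = (b != 0).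
Proof. by case: b => [[|[]]]. Qed.

Lemma ord2_neq (a b : 'I_2) : (a != b) = (b == rev_ord a).
Proof. by case: a b => [[|[]] // ?] [[|[]]]. Qed.

Lemma sign_rev_ord {S : pzRingType} (b : 'I_2) : (-1) ^+ rev_ord b = - (-1) ^+ b :> S.
Proof. by case: b => [[|[]]] //= _; rewrite !subSS ?subnn expr0 expr1 ?opprK. Qed.

Lemma sum_qflip {V : nmodType} {n : nat} (j : 'I_n) (F : 'I_(qdim n) -> V) :
  \sum_a F a = \sum_(a | bits a j == 0) (F a + F (qflip j a)).
Proof.
rewrite big_split /= (bigID (fun a => bits a j == 0)) /=; congr (_ + _).
rewrite (reindex_inj (can_inj (qflipK j))) /=; apply: eq_bigl => a.
by rewrite bits_qflip eqxx rev_ord2 negbK.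
Qed.

Lemma prod_eq_bits {S : comPzSemiRingType} {n : nat} (f g : {ffun 'I_n -> 'I_2}) :
  \prod_(i < n) (f i == g i)%:R = (f == g)%:R :> S.
Proof.
have [-> | fg] := eqVneq f g; first by rewrite big1 // => i _; rewrite eqxx.
have [k] : exists i, f i != g i.
  apply/existsP; apply: contraR fg; rewrite negb_exists => /forallP h.
  by apply/eqP/ffunP => i; apply/eqP; rewrite -[_ == _]negbK.
by move=> /negPf h; rewrite (bigD1 k) //= h mul0r.
Qed.

Lemma qubit_X {R : realType} {n : nat} (j : 'I_n) (w : 'cV[R[i]]_(qdim n)) a :
  (qubit_op j (pauli_mx R PauliX) *m w) a 0 = w (qflip j a) 0.
Proof.
rewrite mxE (bigD1 (qflip j a)) //= [X in _ + X]big1 => [|b ba].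
  rewrite addr0 mxE (_ : \prod_i _ = 1) ?mul1r //.
  rewrite big1 // => i _; rewrite bits_qflip; case: ifP => _.
    by rewrite mxE ord2_neq eqxx.
  by rewrite mxE eqxx.
rewrite mxE (_ : \prod_i _ = (bits b == bits (qflip j a))%:R).
  by rewrite (inj_eq bits_inj) (negPf ba) mul0r.
rewrite -prod_eq_bits; apply: eq_bigr => i _; rewrite bits_qflip.
by case: ifP => _; rewrite mxE ?ord2_neq // eq_sym.
Qed.

Lemma qubit_Z {R : realType} {n : nat} (j : 'I_n) (w : 'cV[R[i]]_(qdim n)) a :
  (qubit_op j (pauli_mx R PauliZ) *m w) a 0 = (-1) ^+ bits a j * w a 0.
Proof.
have Zab b : qubit_op j (pauli_mx R PauliZ) a b = (-1) ^+ bits a j * (bits a == bits b)%:R.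
  rewrite mxE -prod_eq_bits (bigD1 j) //= [in RHS](bigD1 j) //= mulrA eqxx mxE.
  congr (_ * _); first by case: eqP; rewrite ?mulr1 ?mulr0.
  by apply: eq_bigr => i /negPf ->; rewrite mxE.
rewrite mxE (bigD1 a) //= big1 => [|b ba]; first by rewrite addr0 Zab eqxx mulr1.
by rewrite Zab (inj_eq bits_inj) eq_sym (negPf ba) mulr0 mul0r.
Qed.

(** * Graph state amplitudes and the Pauli images of the state *)

(** The eigenvalue, on the basis vector [a], of the product of Z over the neighbours of [j]. *)
Definition nbr_sign (S : comPzRingType) {n : nat} (e : rel 'I_n) (j : 'I_n) (a : 'I_(qdim n)) : S :=
  \prod_(k < n | e j k) (-1) ^+ bits a k.

Lemma stabilizer_amp {R : realType} {n : nat} (e : rel 'I_n) (j : 'I_n)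
    (w : 'cV[R[i]]_(qdim n)) a :
  (stabilizer R e j *m w) a 0 = nbr_sign _ e j (qflip j a) * w (qflip j a) 0.
Proof.
rewrite /stabilizer -mulmxA qubit_X /nbr_sign.
move: (qflip j a) => b; elim/big_rec2: _ w => [|k c M _ IH] w.
  by rewrite mul1mx mul1r.
by rewrite -mulmxA qubit_Z IH mulrA.
Qed.

Lemma sqr_nbr_sign {S : comPzRingType} {n : nat} (e : rel 'I_n) j (a : 'I_(qdim n)) :
  nbr_sign S e j a * nbr_sign S e j a = 1.
Proof.
by rewrite /nbr_sign -big_split big1 //= => k _; rewrite -expr2 sqrr_sign.
Qed.

Lemma nbr_sign_qflip {S : comPzRingType} {n : nat} (e : rel 'I_n) j k (a : 'I_(qdim n)) :
  nbr_sign S e j (qflip k a) = (if e j k then -1 else 1) * nbr_sign S e j a.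
Proof.
rewrite /nbr_sign; case: ifP => ejk.
  rewrite (bigD1 k) //= [in RHS](bigD1 k) //= mulrA; congr (_ * _).
    by rewrite bits_qflip eqxx sign_rev_ord mulN1r.
  by apply: eq_bigr => i /andP[_ /negPf ik]; rewrite bits_qflip ik.
rewrite mul1r; apply: eq_bigr => i eji; rewrite bits_qflip.
by case: eqP eji ejk => // -> ->.
Qed.

(** This is the equation of the [j]-th stabilizer read at [a]: without loops, flipping bit [j] does
    not change the sign, and the sign is its own inverse. *)
Lemma graph_state_qflip {R : realType} {n : nat} (e : rel 'I_n) (psi : 'cV[R[i]]_(qdim n)) j a :
  irreflexive e -> is_graph_state e psi ->
  psi (qflip j a) 0 = nbr_sign _ e j a * psi a 0.
Proof.
move=> e_irr [_ /(_ j) S]; rewrite -[in RHS]S stabilizer_amp.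
by rewrite nbr_sign_qflip e_irr mul1r mulrA sqr_nbr_sign mul1r.
Qed.

(** Flipping bit [l] changes an amplitude only by a sign, so reindexing by the flip turns the sum
    into its opposite. *)
Lemma graph_state_odd_sum {R : realType} {n : nat} (e : rel 'I_n)
    (psi : 'cV[R[i]]_(qdim n)) l (F : 'I_(qdim n) -> R[i]) :
  irreflexive e -> is_graph_state e psi -> (forall a, F (qflip l a) = - F a) ->
  \sum_a F a * `|psi a 0| ^+ 2 = 0.
Proof.
move=> e_irr Spsi Fodd; apply/eqP; rewrite -eqNr; apply/eqP.
rewrite [RHS](reindex_inj (can_inj (qflipK l))) /= -sumrN.
apply: eq_bigr => a _.
have s1 : `|nbr_sign R[i] e l a| ^+ 2 = 1 by rewrite -normrX expr2 sqr_nbr_sign normr1.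
rewrite Fodd mulNr (graph_state_qflip _ _ _ _ e_irr Spsi).
by rewrite normrM exprMn s1 mul1r.
Qed.

(* Amplitudes of [Z^z X^x psi], the Paulis acting on qubit j. *)
Definition pauli_shift {R : realType} {n : nat} (j : 'I_n) (x z : bool)
    (psi : 'cV[R[i]]_(qdim n)) : 'cV[R[i]]_(qdim n) :=
  \col_a ((-1) ^+ (z && (bits a j != 0)) * psi (if x then qflip j a else a) 0).

Lemma norm_sign_mul {R : realType} (b : bool) (x : R[i]) : `|(-1) ^+ b * x| = `|x|.
Proof. by rewrite normrM normrX normrN1 expr1n mul1r. Qed.

Lemma unit_pauli_shift {R : realType} {n : nat} (j : 'I_n) (x z : bool)
    (psi : 'cV[R[i]]_(qdim n)) : unit_ket psi -> unit_ket (pauli_shift j x z psi).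
Proof.
rewrite /unit_ket !norm_colE => <-; case: x.
  rewrite [RHS](reindex_inj (can_inj (qflipK j))) /=.
  by apply: eq_bigr => a _; rewrite mxE norm_sign_mul.
by apply: eq_bigr => a _; rewrite mxE norm_sign_mul.
Qed.

(** The inner product has the form of [graph_state_odd_sum] with weight [F]. If [x] holds, flipping
    the neighbour [k] reverses [nbr_sign] at [j] and keeps bit [j]; otherwise [z] holds and flipping
    [j] reverses the Z sign. *)
Lemma graph_state_pauli_orth {R : realType} {n : nat} (e : rel 'I_n)
    (psi : 'cV[R[i]]_(qdim n)) (j k : 'I_n) (x z : bool) :
  irreflexive e -> is_graph_state e psi -> e j k -> x || z ->
  (psi ^t* *m pauli_shift j x z psi) 0 0 = 0.
Proof.
move=> e_irr Spsi ejk xz; rewrite inner_colE.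
have jk : (j == k) = false by apply/negP => /eqP jk; rewrite jk e_irr in ejk.
pose F a : R[i] := (-1) ^+ (z && (bits a j != 0)) * (if x then nbr_sign _ e j a else 1).
rewrite -[RHS](@graph_state_odd_sum R n e psi (if x then k else j) F) //.
  apply: eq_bigr => a _; rewrite mxE normCK /F; move: ((-1) ^+ _) => t.
  rewrite mulrCA -mulrA; congr (_ * _); case: (x); last by rewrite mul1r mulrC.
  by rewrite (graph_state_qflip _ _ _ _ e_irr Spsi) mulrCA; congr (_ * _); rewrite mulrC.
move=> a; rewrite /F; case: x xz {F} => /= [_|zT].
  by rewrite nbr_sign_qflip ejk bits_qflip jk mulN1r mulrN.
by rewrite zT bits_qflip eqxx rev_ord2 /= !mulr1; case: (_ == _) => /=; rewrite ?expr0 ?expr1 ?opprK.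
Qed.

(** * Overlaps with product vectors and the separable bound *)

(** The weight [B] does not see bit [j], so both halves of the sum share it. The two sums are the
    components, at qubit [j], of [w] contracted with the other factors of [v]. *)
Lemma tens_ket_inner_split {R : realType} {n : nat} (j : 'I_n) (v : 'I_n -> 'cV[R[i]]_2)
    (w : 'cV[R[i]]_(qdim n)) (B := fun a => \prod_(i < n | i != j) (v i (bits a i) 0)^*) :
  ((tens_ket v) ^t* *m w) 0 0 =
    (v j 0 0)^* * (\sum_(a | bits a j == 0) B a * w a 0)
    + (v j 1 0)^* * (\sum_(a | bits a j == 0) B a * w (qflip j a) 0).
Proof.
rewrite inner_colE (sum_qflip j) big_split /= !mulr_sumr; congr (_ + _);
  apply: eq_bigr => a /eqP aj; rewrite mulrA; congr (_ * _);
  rewrite mxE rmorph_prod (bigD1 j) //=.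
  by rewrite aj.
rewrite bits_qflip eqxx aj; congr (_ * _); first by congr (v j _ 0)^*; apply: val_inj.
by apply: eq_bigr => i /negPf ij; rewrite bits_qflip ij.
Qed.

(** The squares on the left are the overlaps of the local factor with X, Z and ZX applied to
    [(y0, y1)]. Their excess over the overlap with [(y0, y1)] itself is twice the squared modulus of
    a determinant, hence nonnegative. *)
Lemma pauli_overlap_identity {C : numClosedFieldType} (a0 a1 y0 y1 : C) :
  `|a0^* * y1 + a1^* * y0| ^+ 2 + `|a0^* * y0 + a1^* * - y1| ^+ 2
    + `|a0^* * y1 + a1^* * - y0| ^+ 2
  = `|a0^* * y0 + a1^* * y1| ^+ 2 + 2 * `|a1 * y0 - a0 * y1| ^+ 2.
Proof. by rewrite !normCK !(rmorphD, rmorphB, rmorphM, rmorphN) /= !conjCK; ring. Qed.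

(* For a product vector the overlap with [psi] is, in terms of the local factor
   (c0, c1) at j, bilinear: c0 y0 + c1 y1, and the Paulis permute and sign y0, y1. *)
Lemma product_overlap_le {R : realType} {n : nat} (j : 'I_n) (v : 'I_n -> 'cV[R[i]]_2)
    (psi : 'cV[R[i]]_(qdim n)) (T := fun w => `|((tens_ket v) ^t* *m w) 0 0| ^+ 2) :
  T psi <= T (pauli_shift j true false psi) + T (pauli_shift j false true psi)
           + T (pauli_shift j true true psi).
Proof.
rewrite /T !(tens_ket_inner_split j).
set B := fun a => \prod_(i < n | i != j) (v i (bits a i) 0)^*.
pose y0 := \sum_(a | bits a j == 0) B a * psi a 0.
pose y1 := \sum_(a | bits a j == 0) B a * psi (qflip j a) 0.
have sum0 x z : \sum_(a | bits a j == 0) B a * pauli_shift j x z psi a 0 = if x then y1 else y0.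
  by case: x; apply: eq_bigr => a /eqP aj; rewrite mxE aj eqxx andbF mul1r.
have sum1 x z : \sum_(a | bits a j == 0) B a * pauli_shift j x z psi (qflip j a) 0
    = (-1) ^+ z * if x then y0 else y1.
  by case: x; rewrite mulr_sumr; apply: eq_bigr => a /eqP aj;
    rewrite mxE bits_qflip eqxx aj ?qflipK andbT mulrCA.
rewrite !sum0 !sum1 -/y0 -/y1 /= expr0 expr1 mul1r !mulN1r.
rewrite [leRHS]pauli_overlap_identity lerDl.
by rewrite mulr_ge0 ?exprn_ge0 ?ler0n.
Qed.

(** The 1 is the expectation of [E] in [psi]; the bound for product vectors is then summed over the
    separable decomposition of [E]. *)
Lemma separable_test_expect {R : realType} {n : nat} (j : 'I_n)
    (psi : 'cV[R[i]]_(qdim n)) (E : 'M[R[i]]_(qdim n)) :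
  unit_ket psi -> separable E -> E *m psi = psi ->
  1 <= expect E (pauli_shift j true false psi) + expect E (pauli_shift j false true psi)
           + expect E (pauli_shift j true true psi).
Proof.
move=> psi1 [K [c [v [c_ge0 _ defE]]]] Epsi.
have {1}<- : expect E psi = 1 by rewrite /expect -mulmxA Epsi.
rewrite defE !expect_sum -!big_split /=; apply: ler_sum => k _.
by rewrite -!mulrDr ler_wpM2l ?lecR // !expect_proj product_overlap_le.
Qed.

Lemma hermsymmx_sum {R : realType} {m K : nat} (p : 'I_K -> R) (E : 'I_K -> 'M[R[i]]_m) :
  (forall k, E k \is hermsymmx) -> \sum_k (p k)%:C *: E k \is hermsymmx.
Proof.
move=> Eh; apply/is_hermitianmxP; rewrite expr0 scale1r.
rewrite linear_sum /= map_mx_sum; apply: eq_bigr => k _.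
rewrite linearZ /= map_mxZ /= conj_Creal; last by apply/complex_realP; exists (p k).
congr (_ *: _).
by have /is_hermitianmxP := Eh k; rewrite expr0 scale1r.
Qed.

Lemma separable_gap_le {R : realType} {n : nat} (e : rel 'I_n)
    (psi : 'cV[R[i]]_(qdim n)) (Omega : 'M[R[i]]_(qdim n)) :
  irreflexive e -> (exists i j, e i j) -> is_graph_state e psi ->
  is_verif_op psi (@separable_based R n) Omega -> spectral_gap Omega <= 2 / 3.
Proof.
move=> e_irr [j [k ejk]] Spsi [K [p [E [p_ge0 p1 test defO]]]].
have psi1 := Spsi.1.
suff : 1 / 3 <= beta Omega by rewrite /spectral_gap; lra.
(* Assuming [beta Omega < 1 / 3] also provides the condition [beta Omega < 1] of
   [expect_le_beta]. *)
rewrite leNgt; apply/negP => b3.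
have Oh : Omega \is hermsymmx by rewrite defO; apply: hermsymmx_sum => l; have [[[]]] := test l.
have Opsi : Omega *m psi = psi.
  rewrite defO mulmx_suml -[RHS]scale1r -(rmorph1 (real_complex R)) -p1 rmorph_sum scaler_suml.
  by apply: eq_bigr => l _; rewrite -scalemxAl; have [[_ _ ->]] := test l.
have small x z : x || z -> expect Omega (pauli_shift j x z psi) <= (beta Omega)%:C.
  move=> xz; apply: (expect_le_beta _ _ _ Oh psi1 Opsi).
  - exact: graph_state_pauli_orth e_irr Spsi ejk xz.
  - exact: unit_pauli_shift.
  - lra.
(* The three expectations sum to at least 1 for each test operator, hence for their convex
   combination, while each is at most [beta Omega]. *)
have : (1 : R)%:C <= (beta Omega + beta Omega + beta Omega)%:C.
  rewrite !rmorphD /=; apply: le_trans (lerD (lerD (small true false isT) (small false true isT)) (small true true isT)).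
  rewrite defO !expect_sum -!big_split /= -p1 rmorph_sum; apply: ler_sum => l _.
  rewrite -!mulrDr -[leLHS]mulr1 ler_wpM2l ?lecR //.
  by have [[_ _ ?] [? _]] := test l; apply: separable_test_expect.
by rewrite lecR; lra.
Qed.

(** * Product eigenbases of Pauli measurements *)

Lemma tens_opM_ket {R : realType} {n : nat} (A : 'I_n -> 'M[R[i]]_2) (v : 'I_n -> 'cV[R[i]]_2) :
  tens_op A *m tens_ket v = tens_ket (fun i => A i *m v i).
Proof.
apply/colP => a; rewrite !mxE.
transitivity (\sum_(f : {ffun 'I_n -> 'I_2}) \prod_i (A i (bits a i) (f i) * v i (f i) 0)).
  by rewrite -sum_bits; apply: eq_bigr => b _; rewrite !mxE big_split.
(* Distributivity turns the sum over bit strings into a product of single-qubit sums. *)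
rewrite -(bigA_distr_bigA (fun i t => A i (bits a i) t * v i t 0)).
by apply: eq_bigr => i _; rewrite mxE.
Qed.

Lemma tens_ketZ {R : realType} {n : nat} (c : 'I_n -> R[i]) (v : 'I_n -> 'cV[R[i]]_2) :
  tens_ket (fun i => c i *: v i) = (\prod_i c i) *: tens_ket v.
Proof.
by apply/colP => a; rewrite !mxE -big_split; apply: eq_bigr => i _; rewrite mxE.
Qed.

Lemma eq_tens_ket {R : realType} {n : nat} (u v : 'I_n -> 'cV[R[i]]_2) :
  u =1 v -> tens_ket u = tens_ket v.
Proof. by move=> uv; apply/colP => a; rewrite !mxE; apply: eq_bigr => i _; rewrite uv. Qed.

Lemma unit_tens_ket {R : realType} {n : nat} (v : 'I_n -> 'cV[R[i]]_2) :
  (forall i, unit_ket (v i)) -> unit_ket (tens_ket v).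
Proof.
move=> v1; rewrite /unit_ket norm_colE.
transitivity (\sum_(f : {ffun 'I_n -> 'I_2}) \prod_i `|v i (f i) 0| ^+ 2).
  rewrite -sum_bits; apply: eq_bigr => a _.
  by rewrite mxE normr_prod prodrXl.
rewrite -(bigA_distr_bigA (fun i t => `|v i t 0| ^+ 2)) big1 // => i _; by rewrite -norm_colE v1.
Qed.

(** The normalized eigenvector of [s] for the eigenvalue [(-1) ^+ v]. *)
Definition pauli_ket (R : realType) (s : pauli) (v : bool) : 'cV[R[i]]_2 :=
  match s with
  | PauliX => \col_a (sqrtC 2^-1 * (if a == 0 then 1 else (-1) ^+ v))
  | PauliY => \col_a (sqrtC 2^-1 * (if a == 0 then 1 else (-1) ^+ v * 'i%C))
  | PauliZ => \col_a (a == v :> nat)%:R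
  end.

Lemma conj_i {R : realType} : ('i%C : R[i])^* = - 'i%C.
Proof. by rewrite complexiE conjCi. Qed.

Lemma i_sq {R : realType} : 'i%C * 'i%C = -1 :> R[i].
Proof. by rewrite -expr2 sqr_i. Qed.

Lemma conj_sqrtC_half {R : realType} : (sqrtC 2^-1 : R[i])^* = sqrtC 2^-1.
Proof. by rewrite geC0_conj // sqrtC_ge0 invr_ge0 ler0n. Qed.

Lemma sqrtC_half {R : realType} :
  sqrtC 2^-1 * sqrtC 2^-1 + sqrtC 2^-1 * sqrtC 2^-1 = 1 :> R[i].
Proof. by rewrite -expr2 sqrtCK; field. Qed.

Lemma pauli_ket_eig {R : realType} (s : pauli) (v : bool) :
  pauli_mx R s *m pauli_ket R s v = (-1) ^+ v *: pauli_ket R s v.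
Proof.
apply/colP => a; rewrite !mxE !big_ord_recl big_ord0.
by case: s; rewrite !mxE; case: a => [[|[]]] //= _; case: v => /=; 
  rewrite ?expr0 ?expr1 /=; ring: (@i_sq R).
Qed.

Lemma pauli_ket_resolution {R : realType} (s : pauli) (a b : 'I_2) :
  \sum_(v : bool) pauli_ket R s v a 0 * (pauli_ket R s v b 0)^* = (a == b)%:R.
Proof.
rewrite big_bool /=.
case: s; rewrite !mxE; case: a => [[|[]]] //= ?; case: b => [[|[]]] //= ?;
  rewrite ?expr0 ?expr1 /= ?rmorphM /= ?rmorphN /= ?conjC1 ?conjC0 ?conj_i ?conj_sqrtC_half /=;
  (* Entries not settled by the square of the imaginary unit alone reduce to twice the square of the
     normalization factor, which is 1. *)
  first [by ring: (@i_sq R) | by apply: (etrans _ (@sqrtC_half R)); ring: (@i_sq R)].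
Qed.

Lemma unit_pauli_ket {R : realType} (s : pauli) (v : bool) : unit_ket (pauli_ket R s v).
Proof.
rewrite /unit_ket inner_colE !big_ord_recl big_ord0.
case: s; rewrite !mxE; case: v => /=;
  rewrite ?expr0 ?expr1 /= ?rmorphM /= ?rmorphN /= ?conjC1 ?conjC0 ?conj_i ?conj_sqrtC_half /=;
  first [by ring: (@i_sq R) | by apply: (etrans _ (@sqrtC_half R)); ring: (@i_sq R)].
Qed.

Definition pauli_basis {R : realType} {n : nat} (s : 'I_n -> pauli)
    (w : {ffun 'I_n -> bool}) : 'cV[R[i]]_(qdim n) :=
  tens_ket (fun i => pauli_ket R (s i) (w i)).

Lemma pauli_basis_resolution {R : realType} {n : nat} (s : 'I_n -> pauli) :
  \sum_w pauli_basis s w *m (pauli_basis s w) ^t* = 1%:M :> 'M[R[i]]_(qdim n).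
Proof.
apply/matrixP => a b; rewrite summxE mxE -(inj_eq (@bits_inj n)) -prod_eq_bits.
under [RHS]eq_bigr => i _ do rewrite -(@pauli_ket_resolution R (s i)).
rewrite bigA_distr_bigA /=; apply: eq_bigr => w _.
by rewrite mxE big_ord1 !mxE rmorph_prod -big_split.
Qed.

(** Multiplying [E] by the resolution of the identity in the product basis leaves eigenvalues times
    product projectors; each eigenvalue is an expectation of [E], so it is real and nonnegative. *)
Lemma diag_separable {R : realType} {n : nat} (s : 'I_n -> pauli) (E : 'M[R[i]]_(qdim n)) :
  psd E -> (forall w, exists c, E *m pauli_basis s w = c *: pauli_basis s w) ->
  separable E.
Proof.
move=> [_ E_ge0] diagE; pose K w : 'cV[R[i]]_(qdim n) := pauli_basis s w.
have K1 w : unit_ket (K w) by apply: unit_tens_ket => i; exact: unit_pauli_ket.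
exists #|{ffun 'I_n -> bool}|, (fun k => complex.Re (expect E (K (enum_val k)))),
  (fun k i => pauli_ket R (s i) ((enum_val k : {ffun 'I_n -> bool}) i)); split.
- by move=> k; have := E_ge0 (K (enum_val k)); rewrite lecE => /andP[].
- by move=> k i; exact: unit_pauli_ket.
rewrite -[LHS]mulmx1 -(pauli_basis_resolution s) mulmx_sumr.
rewrite [LHS](reindex (@enum_val _ {ffun 'I_n -> bool})) /=; last first.
  by apply: onW_bij; exact: enum_val_bij.
apply: eq_bigr => k _; rewrite mulmxA -[tens_ket _]/(K (enum_val k)) -/(K _).
have [c Ec] := diagE (enum_val k).
have -> : expect E (K (enum_val k)) = c.
  by rewrite /expect -mulmxA Ec -scalemxAr mxE (K1 _) mulr1.
rewrite Ec RRe_real ?scalemxAl //.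
have := E_ge0 (K (enum_val k)); rewrite -mulmxA Ec -scalemxAr mxE (K1 _) mulr1.
exact: ger0_real.
Qed.

Lemma pauli_based_diag {R : realType} {n : nat} (E : 'M[R[i]]_(qdim n)) :
  pauli_based E ->
  exists s, forall w, exists c, E *m pauli_basis s w = c *: pauli_basis s w.
Proof.
(* On an unmeasured qubit the local operator is the identity, so any basis diagonalizes it; Z is
   picked. *)
move=> [s [c ->]]; exists (fun i => odflt PauliZ (s i)) => w.
(* [d v i] is the eigenvalue of the local projector: on a measured qubit 1 if the outcomes agree and
   0 otherwise. *)
pose d (v : {ffun 'I_n -> bool}) i : R[i] := if s i is Some _ then 2^-1 * (1 + (-1) ^+ v i * (-1) ^+ w i) else 1.
exists (\sum_v c v * \prod_i d v i); rewrite mulmx_suml scaler_suml.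
apply: eq_bigr => v _; rewrite -scalemxAl tens_opM_ket -scalerA -tens_ketZ.
congr (_ *: _); apply: eq_tens_ket => i; rewrite /d /local_proj.
case: (s i) => [p|] /=; last by rewrite mul1mx scale1r.
by rewrite -scalemxAl mulmxDl mul1mx -scalemxAl pauli_ket_eig -scalerA scalerDl scale1r scalerA.
Qed.

Lemma pauli_based_separable {R : realType} {n : nat} (E : 'M[R[i]]_(qdim n)) :
  psd E -> psd (1%:M - E) -> pauli_based E -> separable_based E.
Proof.
move=> E_ge0 E_le1 /pauli_based_diag [s diagE].
split; first exact: diag_separable diagE.
apply: (diag_separable s) => // w; have [c Ec] := diagE w.
by exists (1 - c); rewrite mulmxBl mul1mx Ec scalerBl scale1r.
Qed.

(** * Comparing the two suprema *)

(** This makes the sets of spectral gaps nonempty, as bounding a [sup] from above requires. *)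
Lemma verif_op1 {R : realType} {n : nat} (psi : 'cV[R[i]]_(qdim n)) :
  is_verif_op psi (@pauli_based R n) 1%:M.
Proof.
have psd1 : psd (1%:M : 'M[R[i]]_(qdim n)).
  split; first exact: hermitian1mx_subproof.
  by move=> v; rewrite mulmx1 norm_colE sumr_ge0 // => a _; rewrite exprn_ge0.
have psd0 : psd (1%:M - 1%:M : 'M[R[i]]_(qdim n)).
  rewrite subrr; split; last by move=> v; rewrite mulmx0 mul0mx mxE.
  by apply/is_hermitianmxP; rewrite trmx0 map_mx0 scaler0.
exists 1%N, (fun _ => 1), (fun _ => 1%:M); split=> //.
- by rewrite big_ord1.
- move=> _; split; first by split=> //; rewrite mul1mx.
  (* Nothing is measured, so every outcome label gives the identity; the indicator weight counts it
     once. *)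
  exists (fun _ => None), (fun v => (v == [ffun=> false])%:R).
  rewrite (bigD1 [ffun=> false]) //= big1 ?addr0 => [|v /negPf ->]; last exact: scale0r.
  rewrite eqxx scale1r; apply/matrixP => a b.
  rewrite !mxE -(inj_eq bits_inj) -prod_eq_bits.
  by apply: eq_bigr => k _; rewrite mxE.
- by rewrite big_ord1 scale1r.
Qed.

Lemma pauli_verif_separable {R : realType} {n : nat} (psi : 'cV[R[i]]_(qdim n)) Omega :
  is_verif_op psi (@pauli_based R n) Omega -> is_verif_op psi (@separable_based R n) Omega.
Proof.
move=> [K [p [E [p_ge0 p1 test defO]]]]; exists K, p, E; split=> // k.
by have [tE pE] := test k; split=> //; case: tE => *; apply: pauli_based_separable.
Qed.

Theorem lemma12 (R : realType) (n : nat) (e : rel 'I_n)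
    (e_sym : symmetric e) (e_irr : irreflexive e)
    (e_edge : exists i j : 'I_n, e i j)
    (psi : 'cV[R[i]]_(qdim n)) (psi_graph : is_graph_state e psi) :
  nu psi <= nu_sep psi /\ nu_sep psi <= 2 / 3.
Proof.
(* The bound serves twice: it is the second inequality, and it makes the separable [sup] a genuine
   upper bound in the first. *)
have ub : ubound (fun x => exists2 Omega, is_verif_op psi (@separable_based R n) Omega
    & spectral_gap Omega = x) (2 / 3).
  by move=> _ [Omega vO <-]; exact: (separable_gap_le _ _ _ e_irr e_edge psi_graph vO).
split; apply: ge_sup.
- by exists (spectral_gap (1%:M : 'M[R[i]]_(qdim n))); exists 1%:M => //; exact: verif_op1.
- move=> _ [Omega vO <-]; apply: ub_le_sup; first by exists (2 / 3); exact: ub.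
  by exists Omega => //; exact: pauli_verif_separable.
- by exists (spectral_gap (1%:M : 'M[R[i]]_(qdim n))); exists 1%:M => //; apply: pauli_verif_separable; exact: verif_op1.
- exact: ub.
Qed.
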